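(* Let $\Omega\subset\mathbb R^2$ be a bounded open convex domain, let $\mu$ be a finite Borel measure on $\Omega$, and let $T(x)=Ax+b$ with $A\in\mathrm{GL}(2,\mathbb R)$ and $b\in\mathbb R^2$. Suppose the zero-boundary Aleksandrov problems for $\mu$ on $\Omega$ and for $T_\#\mu$ on $T\Omega$ have unique continuous concave solutions $F_{\mu,\Omega}$ and $F_{T_\#\mu,T\Omega}$. Then $$F_{T_\#\mu,T\Omega}=|\det A|^{1/2}\,F_{\mu,\Omega}\circ T^{-1}.$$ In particular, the statement holds for (interiors of) rational polygons and for every bounded convex domain.
   Context: For a concave function $F$ on a bounded open convex domain $\Omega$, $\partial^+F(x)=\{p\in\mathbb R^2:F(y)\le F(x)+\langle p,y-x\rangle\ \forall y\in\Omega\}$, and the Aleksandrov Monge-Ampère measure is $\mathrm{MA}(F)(B)=\mathrm{Leb}_2\bigl(\bigcup_{x\in B}\partial^+F(x)\bigr)$ for Borel $B\subset\Omega$. The zero-boundary Aleksandrov problem for $\mu$ on $\Omega$ asks for a continuous concave function $F$ on $\overline\Omega$ with $\mathrm{MA}(F)=\mu$ in $\Omega$ and $F=0$ on $\partial\Omega$; its unique solution is denoted $F_{\mu,\Omega}$. $T_\#\mu$ is the push-forward measure. A rational polygon is a compact convex polygon with nonempty interior whose sides have normals in $\mathbb Z^2$. *)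

(* Defs.v *)
From HB Require Import structures.
From mathcomp Require Export all_boot all_order all_algebra.
From mathcomp Require Export all_classical all_reals all_analysis.
Export numFieldNormedType.Exports.

Set Implicit Arguments.
Unset Strict Implicit.
Unset Printing Implicit Defensive.
Import Order.TTheory GRing.Theory Num.Theory.
Local Open Scope classical_set_scope.
Local Open Scope ring_scope.

(* The plane is [R * R]: its product topology, its max norm and its product
   sigma-algebra are those of the library, and the last one is the Borel
   sigma-algebra of R^2. *)

Section Plane.
Context {R : realType}.
Implicit Types (x y p : R * R) (Omega B P S : set (R * R)) (F : R * R -> R).

Definition dot x y : R := x.1 * y.1 + x.2 * y.2.

Definition linmap (A : 'M[R]_2) x : R * R :=
  (A 0 0 * x.1 + A 0 1 * x.2, A 1 0 * x.1 + A 1 1 * x.2).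

Definition affmap (A : 'M[R]_2) (b : R * R) x : R * R := linmap A x + b.

Definition affmap_inv (A : 'M[R]_2) (b : R * R) y : R * R :=
  linmap (invmx A) (y - b).

(* Two-dimensional Lebesgue outer measure; it agrees with the (completed)
   Lebesgue measure on all Lebesgue measurable sets, not only on Borel ones:
   the sets whose measure is taken in [monge_ampere] need not be Borel. *)
Definition leb2 : set (R * R) -> \bar R :=
  mu_ext (lebesgue_measure \x lebesgue_measure)%E.

Definition superdifferential Omega F x : set (R * R) :=
  [set p | forall y, Omega y -> F y <= F x + dot p (y - x)].

Definition monge_ampere Omega F B : \bar R :=
  leb2 (\bigcup_(x in B) superdifferential Omega F x).

Definition concave_on (D : set (R * R)) F : Prop :=
  convex_function (E := (R * R)%type) D (fun x => - F x).

(* Only the values of [F] on [closure Omega] and those of [mu] on Borel subsets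
   of [Omega] matter. *)
Definition aleksandrov_solution Omega (mu : set (R * R) -> \bar R) F : Prop :=
  [/\ {within closure Omega, continuous F},
      concave_on (closure Omega) F,
      forall B, measurable B -> B `<=` Omega -> monge_ampere Omega F B = mu B
    & forall x, (closure Omega `\` interior Omega) x -> F x = 0].

Definition unique_aleksandrov_solution Omega (mu : set (R * R) -> \bar R) F :
    Prop :=
  aleksandrov_solution Omega mu F /\
  (forall G, aleksandrov_solution Omega mu G ->
     forall x, closure Omega x -> G x = F x).

Definition bounded_convex_domain Omega : Prop :=
  [/\ open Omega, [bounded x | x in Omega] &
      convex_set (M := (R * R)%type) Omega].

(* A convex polygon is the convex hull of a finite set; compactness follows. *)
Definition convex_polygon P : Prop :=
  exists2 V : set (R * R), finite_set V
    & P = smallest (convex_set (M := (R * R)%type)) V.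

Definition side P S : Prop :=
  exists (n : R * R) (c : R),
    [/\ n != 0, forall x, P x -> dot n x <= c,
        S = P `&` [set x | dot n x = c]
      & exists x y, [/\ S x, S y & x != y]].

Definition has_integer_normal S : Prop :=
  exists k l : int, (k, l) != (0, 0) /\
    forall x y, S x -> S y -> dot (k%:~R, l%:~R) (x - y) = 0.

Definition rational_polygon P : Prop :=
  [/\ convex_polygon P, interior P !=set0
    & forall S, side P S -> has_integer_normal S].

End Plane.

(* Main.v *)
(* With [T x = A x + b] and [c = |det A|^(1/2)], the function
   [G = c * (F o T^-1)] solves the transported problem, hence is the solution.
   Indeed the superdifferential of [G] at [T x] is the image of that of [F] at
   [x] under [c * A^-T], whose determinant [c^2 / det A] is 1 or -1; this
   linear map preserves the planar outer measure, being a product of shears and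
   possibly of the exchange of the coordinates. *)
Require Import Defs.
From mathcomp Require Import all_boot all_order all_algebra.
From mathcomp Require Import all_classical all_reals all_analysis.
From mathcomp Require Import measurable_realfun ring lra.
Set Implicit Arguments. Unset Strict Implicit.
Import Order.TTheory GRing.Theory Num.Theory.
Import numFieldNormedType.Exports.
Local Open Scope classical_set_scope.
Local Open Scope ring_scope.

(** * Outer measures under measure-preserving maps *)

(** Pulling back a measurable cover of [E] gives a cover of its preimage with the same total
    measure. *)
Lemma le_mu_ext_preimage d (T : measurableType d) (R : realType)
    (mu : set T -> \bar R) (f : T -> T) :
  measurable_fun setT f ->
  (forall X, measurable X -> mu (f @^-1` X) = mu X) ->
  forall E, (mu_ext mu (f @^-1` E) <= mu_ext mu E)%E.
Proof.
move=> mf muf E; apply: ereal_inf_le_tmp => _ [X [mX EX] <-].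
exists (fun k => f @^-1` X k).
  split=> [k|x /EX [k _ Xk]]; last by exists k.
  by rewrite -[_ @^-1` _]setTI; apply: mf.
by apply: eq_eseriesr => k _; apply: muf.
Qed.

Lemma mu_ext_preimage d (T : measurableType d) (R : realType)
    (mu : set T -> \bar R) (f g : T -> T) :
  cancel g f -> measurable_fun setT f -> measurable_fun setT g ->
  (forall X, measurable X -> mu (f @^-1` X) = mu X) ->
  (forall X, measurable X -> mu (g @^-1` X) = mu X) ->
  forall E, mu_ext mu (f @^-1` E) = mu_ext mu E.
Proof.
move=> gK mf mg muf mug E; apply/eqP; rewrite eq_le le_mu_ext_preimage//=.
rewrite {1}(_ : E = g @^-1` (f @^-1` E)); first exact: le_mu_ext_preimage.
by apply/seteqP; split=> x /=; rewrite gK.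
Qed.

Lemma mulmx22 (R : pzSemiRingType) (M N : 'M[R]_2) i j :
  (M *m N) i j = M i 0 * N 0 j + M i 1 * N 1 j.
Proof.
rewrite mxE !big_ord_recl big_ord0 addr0.
by congr (_ + M i _ * N _ j); apply/val_inj.
Qed.

Lemma det_mx22 (R : comPzRingType) (M : 'M[R]_2) :
  \det M = M 0 0 * M 1 1 - M 0 1 * M 1 0.
Proof.
rewrite (expand_det_row M 0) !big_ord_recl big_ord0 addr0 /cofactor.
rewrite !det_mx11 !mxE.
rewrite (_ : lift 0 0 = 1); last exact/val_inj.
rewrite (_ : lift 1 0 = 0); last exact/val_inj.
by rewrite /= expr0 expr1 mul1r mulN1r mulrN.
Qed.

(** * Invariance of planar Lebesgue outer measure under determinant 1 or -1 *)

Section LebesguePlane.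
Context {R : realType}.
Local Notation lambda := (@lebesgue_measure R).

Lemma lebesgue_measure_translation (c : R) (X : set (measurableTypeR R)) :
  measurable X ->
  pushforward lambda (fun y : measurableTypeR R => y + c : measurableTypeR R) X
  = lambda X.
Proof.
move=> mX; apply/esym/lebesgue_measure_unique => //= [|_ _ [[a b] _ <-]].
  exact: measurable_funD.
rewrite /pushforward (_ : _ @^-1` _ = `](a - c), (b - c)]%classic).
  rewrite !lebesgue_measure_itv/= !lte_fin ltrD2r; case: ifP => // _.
  by rewrite -!EFinD; congr _%:E; ring.
by apply/seteqP; split=> y /=; rewrite !in_itv/=; lra.
Qed.

(** Cavalieri: the shear translates the vertical section at abscissa [x] by [a * x], so the
    integrands agree pointwise. *)
Lemma product_lebesgue_shear (a : R) (X : set (R * R)) : measurable X ->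
  (lambda \x lambda)%E ((fun x : R * R => (x.1, x.2 + a * x.1)) @^-1` X) =
  (lambda \x lambda)%E X.
Proof.
move=> mX; apply: eq_integral => x _ /=.
rewrite -(lebesgue_measure_translation (a * x) (measurable_xsection x mX)).
by congr (lambda _); apply/seteqP; split=> y /=; rewrite /xsection /= !inE.
Qed.

(** A product measure is determined by its values on rectangles, and the exchange maps rectangles to
    rectangles. *)
Lemma product_lebesgue_swap (X : set (R * R)) : measurable X ->
  pushforward (lambda \x lambda)%E
    (@unstable.swap (measurableTypeR R) (measurableTypeR R)) X =
  (lambda \x lambda)%E X.
Proof.
move=> mX; apply/esym/product_measure_unique => // [|mswap A B mA mB].
  exact: measurable_swap.
rewrite /= /pushforward (_ : _ @^-1` _ = B `*` A).
  by rewrite product_measure1E// muleC.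
by apply/seteqP; split=> -[u v] [].
Qed.

Lemma leb2_shear (a : R) (E : set (R * R)) :
  leb2 ((fun x : R * R => (x.1, x.2 + a * x.1)) @^-1` E) = leb2 E.
Proof.
have mS c : measurable_fun setT
    (fun x : measurableTypeR R * measurableTypeR R =>
      (x.1, x.2 + c * x.1) : measurableTypeR R * measurableTypeR R).
  apply: measurable_fun_pair => //; apply: measurable_funD => //.
  exact: measurable_funM.
apply: (@mu_ext_preimage _ (measurableTypeR R * measurableTypeR R)%type
  _ _ _ (fun x => (x.1, x.2 + (- a) * x.1))).
- by case=> u v /=; congr pair; ring.
- exact: mS.
- exact: mS.
- exact: product_lebesgue_shear.
- exact: product_lebesgue_shear.
Qed.

Lemma leb2_swap (E : set (R * R)) :
  leb2 ((fun x : R * R => (x.2, x.1)) @^-1` E) = leb2 E.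
Proof.
have mS : measurable_fun setT
    (@unstable.swap (measurableTypeR R) (measurableTypeR R)).
  exact: measurable_swap.
apply: (@mu_ext_preimage _ (measurableTypeR R * measurableTypeR R)%type
  _ _ _ (@unstable.swap R R)).
- by case.
- exact: mS.
- exact: mS.
- exact: product_lebesgue_swap.
- exact: product_lebesgue_swap.
Qed.

(** Conjugate of the previous shear by the exchange of coordinates. *)
Lemma leb2_shear_swapped (a : R) (E : set (R * R)) :
  leb2 ((fun x : R * R => (x.1 + a * x.2, x.2)) @^-1` E) = leb2 E.
Proof. by rewrite -[RHS]leb2_swap -[RHS](leb2_shear a) -[LHS]leb2_swap. Qed.

(* For [r != 0] the matrix [[p, q], [r, s]] is the product of the shears
   [[1, (p - 1) / r], [0, 1]], [[1, 0], [r, 1]] and [[1, (s - 1) / r], [0, 1]];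
   when [r = 0], one more shear reduces to that case. *)
Lemma leb2_SL2 (p q r s : R) (E : set (R * R)) : p * s - q * r = 1 ->
  leb2 ((fun x : R * R => (p * x.1 + q * x.2, r * x.1 + s * x.2)) @^-1` E) =
  leb2 E.
Proof.
wlog r0 : p q r s E / r != 0.
  move=> wlg; have [r0 det1|] := eqVneq r 0; last exact: wlg.
  have p0 : p != 0.
    by apply: contra_eqN det1 => /eqP ->; rewrite r0 mul0r mulr0 subrr eq_sym
      oner_eq0.
  (* Adding the first row to the second puts [p], nonzero because [p * s = 1], in the lower left
     corner; the shear by -1 undoes this. *)
  rewrite -(leb2_shear (- 1) E) -[RHS](wlg p q p (q + s)) //; last first.
    by rewrite -det1 r0; ring.
  by congr leb2; apply/funext => x; congr E; congr pair => /=; rewrite r0; ring.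
move=> det1.
rewrite -[RHS](leb2_shear_swapped ((p - 1) / r)) -[RHS](leb2_shear r).
rewrite -[RHS](leb2_shear_swapped ((s - 1) / r)); congr leb2.
have qE : q = (p * s - 1) / r by rewrite -det1; field.
by apply/funext => x; congr E; congr pair => /=; rewrite ?qE; field.
Qed.

Lemma leb2_linmap (M : 'M[R]_2) (E : set (R * R)) : `|\det M| = 1 ->
  leb2 (linmap M @^-1` E) = leb2 E.
Proof.
rewrite det_mx22 => detM.
have [det_ge0|det_lt0] := leP 0 (M 0 0 * M 1 1 - M 0 1 * M 1 0).
  by apply: leb2_SL2; rewrite -detM ger0_norm.
(* Exchanging the rows turns determinant -1 into 1. *)
rewrite -[RHS]leb2_swap -[RHS](@leb2_SL2 (M 1 0) (M 1 1) (M 0 0) (M 0 1))//.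
by rewrite -detM ltr0_norm//; ring.
Qed.
End LebesguePlane.

(** * Interior and closure under a homeomorphism *)

Section Homeomorphism.
Context {T U : topologicalType} {f : T -> U} {g : U -> T}.
Hypotheses (fK : cancel f g) (gK : cancel g f).

Lemma image_preimage_cancel (D : set T) : f @` D = g @^-1` D.
Proof.
by apply/seteqP; split=> [_ [x Dx <-] /=|y Dy]; [rewrite fK|exists (g y)].
Qed.

Hypotheses (cf : continuous f) (cg : continuous g).

Lemma homeomorphism_interior (D : set T) :
  interior (g @^-1` D) = g @^-1` interior D.
Proof.
apply/seteqP; split=> y; rewrite /interior /=.
  (* Continuity of [f] gives this inclusion, that of [g] the converse. *)
  move=> Dy; have : nbhs (g y) (f @^-1` (g @^-1` D)) by apply: cf; rewrite gK.
  by apply: filterS => x /=; rewrite fK.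
by move=> /cg.
Qed.

Lemma homeomorphism_closure (D : set T) :
  closure (g @^-1` D) = g @^-1` closure D.
Proof.
by apply: setC_inj; rewrite preimage_setC -!interiorC -homeomorphism_interior.
Qed.

End Homeomorphism.

(** * Affine maps and transport of the Aleksandrov problem *)

Section AffineMaps.
Context {R : realType}.
Implicit Types (M : 'M[R]_2) (b x y p : R * R).

Lemma linmap_mul M N x : linmap (M *m N) x = linmap M (linmap N x).
Proof. by congr pair; rewrite !mulmx22 /=; ring. Qed.

Lemma linmap1 x : linmap 1%:M x = x.
Proof. by case: x => u v; congr pair; rewrite !mxE /=; ring. Qed.

Lemma dot_linmap M p x : dot p (linmap M x) = dot (linmap M^T p) x.
Proof. by rewrite /dot /linmap /= !mxE; ring. Qed.

Lemma linmapB M x y : linmap M (x - y) = linmap M x - linmap M y.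
Proof. by congr pair => /=; ring. Qed.

Lemma linmapZ M (c : R) x : linmap (c *: M) x = c *: linmap M x.
Proof. by congr pair; rewrite !mxE /= /GRing.scale /=; ring. Qed.

Lemma affmap_continuous M b : continuous (affmap M b).
Proof.
move=> x; apply: cvgD; last exact: cvg_cst.
apply: (@cvg_pair _ _ _ (nbhs x) (nbhs (M 0 0 * x.1 + M 0 1 * x.2))
  (nbhs (M 1 0 * x.1 + M 1 1 * x.2))) => /=;
  by apply: cvgD; apply: cvgMl_tmp; [exact: cvg_fst|exact: cvg_snd].
Qed.

Lemma measurable_affmap M b : measurable_fun setT
  (affmap M b : measurableTypeR R * measurableTypeR R ->
                measurableTypeR R * measurableTypeR R).
Proof.
by apply: measurable_fun_pair => /=; apply: measurable_funD => //;
  apply: measurable_funD; apply: measurable_funM.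
Qed.

(** The inverse is itself affine, so facts on [affmap] apply to it. *)
Lemma affmap_invE M b y :
  affmap_inv M b y = affmap (invmx M) (- linmap (invmx M) b) y.
Proof. exact: linmapB. Qed.

Lemma affmapK M b : M \in unitmx -> cancel (affmap M b) (affmap_inv M b).
Proof.
by move=> uM x; rewrite /affmap_inv /affmap addrK -linmap_mul mulVmx// linmap1.
Qed.

Lemma affmap_invK M b : M \in unitmx -> cancel (affmap_inv M b) (affmap M b).
Proof.
by move=> uM x; rewrite /affmap_inv /affmap -linmap_mul mulmxV// linmap1 subrK.
Qed.

Lemma affmap_inv_continuous M b : continuous (affmap_inv M b).
Proof.
rewrite (_ : affmap_inv M b = affmap (invmx M) (- linmap (invmx M) b)).
  exact: affmap_continuous.
by apply/funext => y; exact: affmap_invE.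
Qed.

Lemma affmap_conv M b (t : {i01 R}) (x y : convex_lmodType (R * R)%type) :
  affmap M b (conv t x y) =
  conv t (affmap M b x : convex_lmodType (R * R)%type) (affmap M b y).
Proof.
rewrite /conv /= /affmap /linmap; congr pair;
  by rewrite /= /GRing.scale /= /unstable.onem; ring.
Qed.

(** Dividing the supporting inequality by [c] and moving [M] to the other side of the pairing turns
    the slope [p] into [c^-1 M^T p]. *)
Lemma superdifferential_affmap (Omega : set (R * R)) F M b (c : R) x :
  0 < c -> M \in unitmx ->
  superdifferential (affmap M b @` Omega)
    (fun y => c * F (affmap_inv M b y)) (affmap M b x) =
  linmap (c^-1 *: M^T) @^-1` superdifferential Omega F x.
Proof.
move=> c0 uM.
have E p y : (F y <= F x + dot (linmap (c^-1 *: M^T) p) (y - x)) =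
    (c * F y <= c * F x + dot p (affmap M b y - affmap M b x)).
  rewrite -(ler_pM2l c0) mulrDr; congr (_ <= _ + _).
  rewrite /affmap opprD addrACA subrr addr0 -linmapB dot_linmap linmapZ.
  by rewrite /dot /= /GRing.scale /=; field; exact: lt0r_neq0.
apply/seteqP; split=> p /= pG => [y Oy|_ [y Oy <-]].
  by rewrite E; have := pG _ (imageP _ Oy); rewrite !affmapK.
by rewrite !affmapK// -E; exact: pG.
Qed.

Lemma monge_ampere_affmap (Omega : set (R * R)) F M b B :
  M \in unitmx ->
  monge_ampere (affmap M b @` Omega)
    (fun y => Num.sqrt `|\det M| * F (affmap_inv M b y)) B =
  monge_ampere Omega F (affmap M b @^-1` B).
Proof.
move=> uM; set c := Num.sqrt _.
have detM : \det M != 0 by move: uM; rewrite unitmxE unitfE.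
have c0 : 0 < c by rewrite sqrtr_gt0 normr_gt0.
have c2 : c ^+ 2 = `|\det M| by rewrite sqr_sqrtr.
(* In dimension 2 this determinant has absolute value [c^-2 * |det M|], which is 1 by the choice of
   [c]. *)
rewrite /monge_ampere -[RHS](@leb2_linmap _ (c^-1 *: M^T)); last first.
  rewrite detZ det_tr normrM normrX gtr0_norm ?invr_gt0// exprVn c2 mulVf//.
  by rewrite normr_eq0.
congr leb2; rewrite preimage_bigcup.
(* Reindexes the union over [B] by points of the source. *)
rewrite -[B in LHS](_ : affmap M b @` (affmap M b @^-1` B) = B); last first.
  by rewrite (image_preimage_cancel (affmapK b uM) (affmap_invK b uM));
    apply/funext => y /=; rewrite affmap_invK.
rewrite bigcup_image; apply: eq_bigcupr => x _.
exact: superdifferential_affmap.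
Qed.

Lemma aleksandrov_solution_affmap (Omega : set (R * R))
    (mu : set (R * R) -> \bar R) F M b :
  M \in unitmx -> aleksandrov_solution Omega mu F ->
  aleksandrov_solution (affmap M b @` Omega) (pushforward mu (affmap M b))
    (fun y => Num.sqrt `|\det M| * F (affmap_inv M b y)).
Proof.
move=> uM [cF vF maF F0].
have fK := affmapK b uM; have gK := affmap_invK b uM.
have cf : continuous (affmap M b) by exact: affmap_continuous.
have cg : continuous (affmap_inv M b) by exact: affmap_inv_continuous.
have imE := image_preimage_cancel fK gK.
have clE : closure (affmap M b @` Omega) = affmap_inv M b @^-1` closure Omega.
  by rewrite imE (homeomorphism_closure fK gK cf cg).
have intE : interior (affmap M b @` Omega) =
    affmap_inv M b @^-1` interior Omega.
  by rewrite imE (homeomorphism_interior fK gK cf cg).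
split.
- rewrite clE; apply/subspace_continuousP => y Dy /=.
  apply: cvgMl_tmp; move/subspace_continuousP : cF => /(_ _ Dy).
  (* The closures correspond, so relative neighbourhoods pull back by plain continuity of the
     inverse. *)
  by apply: cvg_comp => X; exact: (cg y).
- rewrite clE => t x y; rewrite !inE /= => Dx Dy.
  have := vF t (affmap_inv M b x) (affmap_inv M b y).
  rewrite !inE => /(_ Dx Dy).
  (* The inverse commutes with convex combinations; the inequality for [F] is then scaled by a
     nonnegative factor. *)
  rewrite !affmap_invE affmap_conv !convRE /=.
  by move=> /(ler_wpM2l (sqrtr_ge0 `|\det M|)); lra.
- move=> B mB BO; rewrite monge_ampere_affmap// maF//.
    by rewrite -[_ @^-1` _]setTI; exact: measurable_affmap.
  (* By injectivity, the preimage of [B] lies in [Omega]. *)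
  by move=> x /BO [y Oy]; move/(can_inj fK) <-.
- by move=> y; rewrite clE intE => /F0 /= ->; rewrite mulr0.
Qed.

(** The rescaled [F] solves the problem whose unique solution is [F']. *)
Lemma unique_aleksandrov_solution_affmap (Omega : set (R * R))
    (mu : set (R * R) -> \bar R) M b F F' :
  M \in unitmx ->
  unique_aleksandrov_solution Omega mu F ->
  unique_aleksandrov_solution (affmap M b @` Omega)
    (pushforward mu (affmap M b)) F' ->
  forall y, closure (affmap M b @` Omega) y ->
    F' y = Num.sqrt `|\det M| * F (affmap_inv M b y).
Proof.
move=> uM [solF _] [_ uniF'] y Oy.
exact/esym/(uniF' _ (aleksandrov_solution_affmap b uM solF)).
Qed.

End AffineMaps.

Theorem theorem10p2 (R : realType) :
  (forall (Omega : set (R * R)%type) (mu : {finite_measure set (R * R)%type -> \bar R})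
      (A : 'M[R]_2) (b : (R * R)%type) (F F' : (R * R)%type -> R),
    bounded_convex_domain Omega ->
    mu (~` Omega) = 0%E ->
    A \in unitmx ->
    unique_aleksandrov_solution Omega mu F ->
    unique_aleksandrov_solution (affmap A b @` Omega)
      (pushforward mu (affmap A b)) F' ->
    forall y, closure (affmap A b @` Omega) y ->
      F' y = Num.sqrt `|\det A| * F (affmap_inv A b y))
  /\
  (forall (P : set (R * R)%type) (mu : {finite_measure set (R * R)%type -> \bar R})
      (A : 'M[R]_2) (b : (R * R)%type) (F F' : (R * R)%type -> R),
    rational_polygon P ->
    mu (~` interior P) = 0%E ->
    A \in unitmx ->
    unique_aleksandrov_solution (interior P) mu F ->
    unique_aleksandrov_solution (affmap A b @` interior P)
      (pushforward mu (affmap A b)) F' ->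
    forall y, closure (affmap A b @` interior P) y ->
      F' y = Num.sqrt `|\det A| * F (affmap_inv A b y)).
Proof.
split=> D mu A b F F' _ _ uA; exact: unique_aleksandrov_solution_affmap.
Qed.
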